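(* Let $\mathcal{B}$ be a right-sided reproducing kernel Banach space of functions on $\Omega$ with the right-sided reproducing kernel $K\in L_0(\Omega\times\Omega')$. If the right-sided kernel set $\{K(x,\cdot):x\in\Omega\}$ is compact in the dual space $\mathcal{B}'$ of $\mathcal{B}$, then the identity map from $\mathcal{B}$ into $\mathbb{L}_\infty(\Omega)$ is compact.
   Context: $\Omega,\Omega'$ are locally compact Hausdorff spaces equipped with regular Borel measures $\mu,\mu'$. $L_0(X)$ denotes the set of real-valued measurable functions on $X$ (genuine functions). $\mathbb{L}_\infty(\Omega):=\{f\in L_0(\Omega):\sup_{x\in\Omega}|f(x)|<\infty\}$ with the uniform norm $\|f\|_\infty:=\sup_{x\in\Omega}|f(x)|$. A linear operator is compact if it maps bounded sets to relatively compact sets. For a Banach space $\mathcal{B}$, $\mathcal{B}'$ is its continuous dual and $\langle f,G\rangle_{\mathcal{B}}:=G(f)$. Right-sided reproducing kernel Banach space: let $K\in L_0(\Omega\times\Omega')$ and let $\mathcal{B}$ be a Banach space consisting of functions in $L_0(\Omega)$ whose dual $\mathcal{B}'$ is isometrically isomorphic to a normed space $\mathcal{F}$ consisting of functions in $L_0(\Omega')$; $\mathcal{F}$ is fixed and identified with $\mathcal{B}'$. $\mathcal{B}$ is a right-sided reproducing kernel Banach space with right-sided reproducing kernel $K$ if $K(x,\cdot)\in\mathcal{F}\cong\mathcal{B}'$ for each $x\in\Omega$, and $\langle f,K(x,\cdot)\rangle_{\mathcal{B}}=f(x)$ for all $f\in\mathcal{B}$ and all $x\in\Omega$. *)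

(* Defs.v *)
From HB Require Import structures.
From mathcomp Require Import all_boot all_order all_algebra.
From mathcomp Require Import all_classical all_reals all_analysis.
From mathcomp Require Import measurable_realfun.

Set Implicit Arguments.
Unset Strict Implicit.
Unset Printing Implicit Defensive.

Import Order.TTheory GRing.Theory Num.Theory.
Import numFieldNormedType.Exports.

Local Open Scope classical_set_scope.
Local Open Scope ring_scope.

HB.instance Definition _ (X Y : ptopologicalType) := Pointed.on (X * Y)%type.

Notation borel X := (g_sigma_algebraType (@open X)).

(* Regularity for locally compact Hausdorff spaces (Cohn, Folland): finite on
   compact sets, outer regular on Borel sets, inner regular on open sets. *)
Definition regular_measure (R : realType) (X : ptopologicalType)
    (mu : {measure set (borel X) -> \bar R}) : Prop :=
  [/\ forall A : set X, compact A -> (mu A < +oo)%E,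
      forall A : set (borel X), measurable A ->
        mu A = ereal_inf [set mu U | U in [set U : set X | open U /\ A `<=` U]]
    & forall U : set X, open U ->
        mu U = ereal_sup [set mu C | C in [set C : set X | compact C /\ C `<=` U]]].

(* Genuine functions, not classes modulo null sets: the measure plays no role.
   On a product space, borel is the Borel sigma-algebra of the product topology;
   it contains the product of the two Borel sigma-algebras. *)
Definition L0 (R : realType) (X : ptopologicalType) : set (X -> R) :=
  [set f | measurable_fun [set: borel X] (f : borel X -> R)].

Section Linfty.
Variables (R : realType) (X : ptopologicalType).

Definition Linfty_pred : {pred (X -> R)} :=
  mem [set f : X -> R | @L0 R X f /\ bounded_fun f].

Let bounded_funE (f : X -> R) :
  bounded_fun f <-> exists M, forall x, `|f x| <= M.
Proof.
split=> [[M [_ fM]]|[M fM]].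
  by exists (M + 1) => x; apply: fM => //; rewrite ltrDl.
exists M; split; first exact: num_real.
by move=> N MN x _; exact: le_trans (fM x) (ltW MN).
Qed.

Lemma Linfty_submod_closed : submod_closed Linfty_pred.
Proof.
split.
- rewrite inE; split; first exact: measurable_cst.
  by apply/bounded_funE; exists 0 => x /=; rewrite normr0.
- move=> a f g; rewrite !inE => -[mf bf] [mg bg]; split.
    by apply: measurable_funD => //; exact: measurable_funM.
  move/bounded_funE: bf => [M fM]; move/bounded_funE: bg => [N gN].
  apply/bounded_funE; exists (`|a| * M + N) => x.
  rewrite -[X in `|X|]/(a * f x + g x) (le_trans (ler_normD _ _))// lerD//.
  by rewrite normrM ler_wpM2l//; exact: fM.
Qed.

HB.instance Definition _ := GRing.isSubmodClosed.Build R (X -> R) Linfty_pred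
  Linfty_submod_closed.

Record Linfty := MkLinfty { Linfty_fun :> X -> R ; _ : Linfty_fun \in Linfty_pred }.

HB.instance Definition _ := [isSub for Linfty_fun].
HB.instance Definition _ := [Choice of Linfty by <:].
HB.instance Definition _ := [SubChoice_isSubLmodule of Linfty by <:].

Definition Linfty_norm (f : Linfty) : R := sup (range (fun x => `|f x|)).

Lemma Linfty_bound (f : Linfty) x : `|f x| <= Linfty_norm f.
Proof.
have [_ /bounded_funE[M fM]] := set_mem (valP f).
apply: ub_le_sup; last by exists x.
by exists M => _ [y _ <-]; exact: fM.
Qed.

Lemma Linfty_norm_le (f : Linfty) M :
  (forall x, `|f x| <= M) -> Linfty_norm f <= M.
Proof.
move=> fM; apply: ge_sup; last by move=> _ [x _ <-].
by exists `|f point|; exists point.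
Qed.

Lemma Linfty_normD f g : Linfty_norm (f + g) <= Linfty_norm f + Linfty_norm g.
Proof.
apply: Linfty_norm_le => x.
by rewrite (le_trans (ler_normD _ _))// lerD//; exact: Linfty_bound.
Qed.

Lemma Linfty_normZ a f : Linfty_norm (a *: f) = `|a| * Linfty_norm f.
Proof.
have le b g : Linfty_norm (b *: g) <= `|b| * Linfty_norm g.
  apply: Linfty_norm_le => x.
  by rewrite normrM ler_wpM2l//; exact: Linfty_bound.
apply/eqP; rewrite eq_le le/=; have [->|a0] := eqVneq a 0.
  rewrite normr0 mul0r; apply: le_trans (Linfty_bound _ point).
  exact: normr_ge0.
rewrite -ler_pdivlMl ?normr_gt0// -normfV.
by rewrite -{1}(scalerK a0 f); exact: le.
Qed.

Lemma Linfty_norm0 f : Linfty_norm f = 0 -> f = 0.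
Proof.
move=> f0; apply/val_inj/funext => x /=; apply/normr0_eq0/eqP.
by rewrite eq_le normr_ge0 andbT -f0; exact: Linfty_bound.
Qed.

HB.instance Definition _ := Lmodule_isNormed.Build R Linfty
  Linfty_normD Linfty_normZ Linfty_norm0.

End Linfty.

Section dual.
Variables (R : realType) (V : normedModType R).

Definition dual_pred : {pred (V -> R)} :=
  mem [set G : V -> R | linear G /\ continuous G].

Lemma dual_submod_closed : submod_closed dual_pred.
Proof.
split.
- rewrite inE; split; last exact: cst_continuous.
  by move=> a u v; rewrite /= scaler0 addr0.
- move=> a f g; rewrite !inE => -[lf cf] [lg cg]; split.
    move=> b u v; rewrite -[LHS]/(a * f (b *: u + v) + g (b *: u + v)).
    rewrite -[RHS]/(b * (a * f u + g u) + (a * f v + g v)) lf lg.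
    rewrite -[b *: f u]/(b * f u) -[b *: g u]/(b * g u).
    by rewrite !mulrDr !mulrA [b * a]mulrC addrACA.
  move=> x; apply: cvgD; last exact: cg.
  by apply: cvgZr; exact: cf.
Qed.

HB.instance Definition _ := GRing.isSubmodClosed.Build R (V -> R) dual_pred
  dual_submod_closed.

Record dual := MkDual { dual_fun :> V -> R ; _ : dual_fun \in dual_pred }.

HB.instance Definition _ := [isSub for dual_fun].
HB.instance Definition _ := [Choice of dual by <:].
HB.instance Definition _ := [SubChoice_isSubLmodule of dual by <:].

Definition dual_norm (G : dual) : R :=
  sup [set `|G v| | v in [set v : V | `|v| <= 1]].

Lemma dual_linear (G : dual) : linear G.
Proof. by case: G => G /=; rewrite inE => -[]. Qed.

HB.instance Definition _ (G : dual) :=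
  GRing.isLinear.Build R V R *:%R G (dual_linear G).

Lemma dual_continuous (G : dual) : continuous G.
Proof. by case: G => G /=; rewrite inE => -[]. Qed.

Lemma dual_bound (G : dual) v : `|v| <= 1 -> `|G v| <= dual_norm G.
Proof.
move=> v1; apply: ub_le_sup; last by exists v.
have /linear_bounded_continuous/bounded_funP/(_ 1)[M GM] := @dual_continuous G.
by exists M => _ [w w1 <-]; exact: GM.
Qed.

Lemma dual_norm_le (G : dual) M :
  (forall v, `|v| <= 1 -> `|G v| <= M) -> dual_norm G <= M.
Proof.
move=> GM; apply: ge_sup; last by move=> _ [v v1 <-]; exact: GM.
by exists `|G 0|; exists 0 => //=; rewrite normr0.
Qed.

Lemma dual_normD G H : dual_norm (G + H) <= dual_norm G + dual_norm H.
Proof.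
apply: dual_norm_le => v v1.
by rewrite (le_trans (ler_normD _ _))// lerD//; exact: dual_bound.
Qed.

Lemma dual_normZ a G : dual_norm (a *: G) = `|a| * dual_norm G.
Proof.
have le b H : dual_norm (b *: H) <= `|b| * dual_norm H.
  apply: dual_norm_le => v v1.
  by rewrite normrM ler_wpM2l//; exact: dual_bound.
apply/eqP; rewrite eq_le le/=; have [->|a0] := eqVneq a 0.
  rewrite normr0 mul0r; apply: le_trans (@dual_bound _ 0 _).
    exact: normr_ge0.
  by rewrite normr0.
rewrite -ler_pdivlMl ?normr_gt0// -normfV.
by rewrite -{1}(scalerK a0 G); exact: le.
Qed.

Lemma dual_norm0 G : dual_norm G = 0 -> G = 0.
Proof.
move=> G0; apply/val_inj/funext => v /=.
have [->|v0] := eqVneq v 0; first exact: (linear0 G).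
have : G (`|v|^-1 *: v) = 0.
  apply/normr0_eq0/eqP; rewrite eq_le normr_ge0 andbT -G0.
  by apply: dual_bound; rewrite normfZV.
rewrite linearZ /= => /eqP; rewrite scaler_eq0 invr_eq0 normr_eq0 (negPf v0).
by move/eqP.
Qed.

HB.instance Definition _ := Lmodule_isNormed.Build R dual
  dual_normD dual_normZ dual_norm0.

End dual.

Definition compact_operator (R : realType) (V W : normedModType R)
    (T : {linear V -> W}) : Prop :=
  forall A : set V, bounded_set A -> precompact (T @` A).

(* A normed space consisting of functions in L0 X is a normed space V with an
   injective linear map ev into L0 X; ev v is the function that v is. *)
Definition consists_of_functions (R : realType) (X : ptopologicalType)
    (V : normedModType R) (ev : {linear V -> (X -> R)}) : Prop :=
  injective ev /\ forall v : V, @L0 R X (ev v).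

Definition isometric_isomorphism (R : realType) (V W : normedModType R)
    (T : {linear V -> W}) : Prop :=
  bijective T /\ forall v : V, `|T v| = `|v|.

(* B and F are function spaces on X and Y through evB and evF, and J is the
   fixed isometric isomorphism that identifies F with the dual of B. *)
Section rkbs.
Variables (R : realType) (X Y : ptopologicalType).
Variables (B : completeNormedModType R) (evB : {linear B -> (X -> R)}).
Variables (F : normedModType R) (evF : {linear F -> (Y -> R)}).
Variables (J : {linear F -> dual B}) (K : X * Y -> R).

Definition right_sided_RKBS : Prop :=
  [/\ consists_of_functions evB,
      consists_of_functions evF,
      isometric_isomorphism J,
      @L0 R (X * Y)%type K
    & forall x : X, exists2 k : F, evF k = (fun y => K (x, y))
        & forall f : B, J k f = evB f x].

Definition right_sided_kernel_set : set (dual B) :=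
  [set J k | k in [set k : F | exists x : X, evF k = (fun y => K (x, y))]].

End rkbs.

(* Main.v *)
From HB Require Import structures.
Require Import Defs.
From mathcomp Require Import all_boot all_order all_algebra.
From mathcomp Require Import all_classical all_reals all_analysis.
From mathcomp Require Import finmap measurable_realfun lra.

Set Implicit Arguments.
Unset Strict Implicit.
Unset Printing Implicit Defensive.

Import Order.TTheory GRing.Theory Num.Theory.
Import numFieldNormedType.Exports.

Local Open Scope classical_set_scope.
Local Open Scope ring_scope.

(* Write k x for K(x, .) seen in the dual of B. If |f| <= M then
   |f x - f y| = |<f, k x - k y>| <= M |k x - k y|, so a bounded subset of B is
   equi-Lipschitz for the pseudometric |k x - k y| on Omega, which is totally
   bounded because {k x} is compact. As in the Arzela-Ascoli theorem, an
   ultrafilter of such functions that converges pointwise converges uniformly;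
   the limit is measurable, being the limit of a sequence of measurable
   functions. *)

(** Used for evaluation at a point: it turns an ultrafilter of functions into an ultrafilter of
    reals. *)
Lemma fmap_ultra (T U : Type) (f : T -> U) (F : set_system T) :
  UltraFilter F -> UltraFilter (f @ F).
Proof.
move=> UF; apply: Build_UltraFilter => G PG FG; apply/seteqP; split=> // A GA.
have [//|FA] := in_ultra_setVsetC (f @^-1` A) UF.
by have /filter_ex[x []] : G (~` A `&` A) by apply: filterI => //; exact: FG.
Qed.

(** The net consists of indices rather than of their images, so that functions on [I] can be
    evaluated at its points. *)
Lemma compact_finite_net (R : realType) (V : normedModType R) (I : choiceType)
    (k : I -> V) (e : R) : compact (range k) -> 0 < e ->
  exists D : {fset I}, forall x, exists2 y, y \in D & `|k y - k x| < e.
Proof.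
rewrite compact_cover => ck e0.
have [||D _ kD] := ck I setT (fun y => ball (k y) e).
- by move=> y _; exact: ball_open.
- by move=> _ [y _ <-]; exists y => //; exact: ballxx.
exists D => x; have [|y yD] := kD (k x); first by exists x.
by rewrite -ball_normE => kyx; exists y.
Qed.

Lemma dual_le_norm (R : realType) (V : normedModType R) (G : dual V) (v : V) :
  `|G v| <= `|G| * `|v|.
Proof.
have [->|v0] := eqVneq v 0; first by rewrite linear0 !normr0 mulr0.
have : `|G (`|v|^-1 *: v)| <= `|G| by apply: dual_bound; rewrite normfZV.
by rewrite linearZ /= normrZ normfV normr_id mulrC ler_pdivrMr ?normr_gt0//.
Qed.

Section Linfty_compactness.
Variables (R : realType) (X : ptopologicalType).

Lemma Linfty_measurable (f : Linfty R X) : L0 (f : X -> R).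
Proof. by have [] := set_mem (valP f). Qed.

Lemma bounded_Linfty (f : X -> R) (C : R) :
  L0 f -> (forall x, `|f x| <= C) -> f \in @Linfty_pred R X.
Proof.
move=> mf fC; apply: mem_set; split=> //; exists C; split; first exact: num_real.
by move=> N CN x _; exact: le_trans (fC x) (ltW CN).
Qed.

Lemma Linfty_uniform_cvg (F : set_system (Linfty R X)) (f : Linfty R X) :
  Filter F ->
  (forall e : R, 0 < e -> F [set g : Linfty R X | forall x, `|f x - g x| <= e]) ->
  F --> f.
Proof.
move=> FF Ff; apply/cvgrPdist_le => e e0; apply: filterS (Ff _ e0) => g fg.
exact: Linfty_norm_le.
Qed.

Lemma L0_uniform_limit (F : set_system (Linfty R X)) (phi : X -> R) :
  ProperFilter F ->
  (forall e : R, 0 < e -> F [set g : Linfty R X | forall x, `|phi x - g x| <= e]) ->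
  L0 phi.
Proof.
move=> PF Fphi.
have /choice[h hphi] n : exists g : Linfty R X,
    forall x, `|phi x - g x| <= n.+1%:R^-1.
  exact: filter_ex (Fphi _ _).
apply: (@measurable_fun_cvg _ (borel X) _ _ (fun n => h n : borel X -> R)).
  by move=> n; exact: Linfty_measurable.
move=> x _; apply/cvgrPdist_le => e e0.
apply: filterS (cvgr0_norm_le _ (@cvg_harmonic R) e e0) => n /= ne.
apply: le_trans (hphi n x) _.
exact: le_trans (ler_norm _) ne.
Qed.

(** Both conditions are non-strict inequalities and survive pointwise limits, so the set itself is
    compact. *)
Lemma Linfty_equilipschitz_compact (V : normedModType R) (k : X -> V) (C M : R) :
  compact (range k) -> 0 <= M ->
  compact [set f : Linfty R X | (forall x, `|f x| <= C) /\
    forall x y, `|f x - f y| <= M * `|k x - k y|].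
Proof.
move=> ck M0; rewrite compact_ultra => F UF FS.
(* At each point the values stay in the compact segment from [- C] to [C], where the image
   ultrafilter converges. *)
have /choice[phi Fphi] x :
    exists l : R, (f x @[f --> F] --> l).
  have := @segment_compact R (- C) C; rewrite compact_ultra.
  move=> /(_ _ (fmap_ultra (fun f : Linfty R X => f x) UF)) /=.
  case=> [|l [_ Fl]].
    by apply: filterS FS => f [/(_ x) + _]; rewrite /= in_itv /= ler_norml.
  by exists l.
have phiC x : `|phi x| <= C.
  apply: (ler_cvg_to (cvg_norm (Fphi x)) (cvg_cst C)).
  by apply: filterS FS => f [].
have phiM x y : `|phi x - phi y| <= M * `|k x - k y|.
  apply: (ler_cvg_to (cvg_norm (cvgB (Fphi x) (Fphi y))) (cvg_cst _)).
  by apply: filterS FS => f [_ fM]; exact: fM.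
have Funif (e : R) : 0 < e -> F [set g : Linfty R X | forall x, `|phi x - g x| <= e].
  move=> e0.
  (* Three errors of [e / 3]: from [phi x] to [phi y], to [g y], to [g x], with [y] in the net.
     Dividing by [M + 1] also covers [M = 0]. *)
  have M1 : 0 < M + 1 by lra.
  have d0 : 0 < e / 3 / (M + 1) by rewrite !divr_gt0.
  have [D netD] := compact_finite_net ck d0.
  (* The net is finite, so closeness at all its points still holds on a set of the filter. *)
  have FD : F (\bigcap_(y in [set` D]) [set g : Linfty R X | `|phi y - g y| <= e / 3]).
    apply: filter_bigI => y _.
    by move/cvgrPdist_le: (Fphi y); apply; rewrite divr_gt0.
  apply: filterS (filterI FD FS) => g [gD [_ gM]] x.
  have [y yD kyx] := netD x.
  have gy : `|phi y - g y| <= e / 3 by exact: gD.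
  have Mk : M * `|k y - k x| <= e / 3.
    apply: (@le_trans _ _ ((M + 1) * `|k y - k x|)).
      by rewrite ler_wpM2r// lerDl.
    by rewrite mulrC -ler_pdivlMr// ltW.
  have phiyx := le_trans (phiM y x) Mk; have gyx := le_trans (gM y x) Mk.
  by move: phiyx gyx gy; rewrite !ler_norml; lra.
have mphi : L0 phi by exact: L0_uniform_limit Funif.
exists (MkLinfty (bounded_Linfty mphi phiC)); split=> //.
exact: Linfty_uniform_cvg.
Qed.

End Linfty_compactness.

Theorem proposition2p20 (R : realType) (Omega Omega' : ptopologicalType)
  (lcOmega : locally_compact [set: Omega]) (hOmega : hausdorff_space Omega)
  (lcOmega' : locally_compact [set: Omega']) (hOmega' : hausdorff_space Omega')
  (mu : {measure set (borel Omega) -> \bar R}) (regmu : regular_measure mu)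
  (mu' : {measure set (borel Omega') -> \bar R}) (regmu' : regular_measure mu')
  (B : completeNormedModType R) (evB : {linear B -> (Omega -> R)})
  (F : normedModType R) (evF : {linear F -> (Omega' -> R)})
  (J : {linear F -> dual B}) (K : Omega * Omega' -> R)
  (rkbsB : right_sided_RKBS evB evF J K)
  (compactK : compact (right_sided_kernel_set evF J K)) :
  exists2 id_B : {linear B -> Linfty R Omega},
    forall f : B, id_B f = evB f :> (Omega -> R)
  & compact_operator id_B.
Proof.
have [[_ mB] [injF _] _ _ repr] := rkbsB.
have /choice[k kP] x : exists k : F, evF k = (fun y => K (x, y)) /\
    forall f : B, J k f = evB f x.
  by have [k] := repr x; exists k.
have ck : compact (range (J \o k)).
  suff -> : range (J \o k) = right_sided_kernel_set evF J K by [].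
  apply/seteqP; split=> [_ [x _ <-]|_ [u [x ux] <-]].
    by exists (k x) => //; exists x; case: (kP x).
  (* Injectivity of [evF] makes [k x] the only element of [F] representing K(x, .). *)
  by exists x => //=; congr (J _); apply: injF; case: (kP x) => -> _.
have [N N0 kN] : exists2 N, 0 <= N & forall x, `|J (k x)| <= N.
  have [N [_ kN]] := compact_bounded ck.
  have k1 x : `|J (k x)| <= N + 1 by apply: kN; [rewrite ltrDl|exists x].
  (* [N + 1] bounds a norm at [point], hence is nonnegative. *)
  by exists (N + 1) => //; exact: le_trans (k1 point).
have evB_le f x : `|evB f x| <= N * `|f|.
  rewrite -(kP x).2; apply: le_trans (dual_le_norm _ _) _.
  by rewrite ler_wpM2r.
have evB_lip f x y : `|evB f x - evB f y| <= `|f| * `|J (k x) - J (k y)|.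
  by rewrite -(kP x).2 -(kP y).2 mulrC; exact: (dual_le_norm (J (k x) - J (k y))).
pose T f := MkLinfty (bounded_Linfty (mB f) (evB_le f)).
have linT : linear T by move=> a f g; apply/val_inj; rewrite /= linearP.
pose TL := GRing.isLinear.Build R B (Linfty R Omega) *:%R T linT.
pose id_B : {linear B -> Linfty R Omega} := HB.pack T TL.
exists id_B => // A [M [_ AM]].
(* If [A] is empty, [M + 1] may be negative. *)
pose L := Num.max 0 (M + 1).
have L_ge0 : 0 <= L by rewrite le_max lexx.
have AL f : A f -> `|f| <= L.
  by move=> Af; rewrite le_max; apply/orP; right; apply: AM => //; rewrite ltrDl.
have cS := Linfty_equilipschitz_compact (C := N * L) ck L_ge0.
(* The image of [A] lies in the compact set [cS], which is closed because the space is Hausdorff. *)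
apply: precompact_subset (_ : precompact _); last first.
  by rewrite precompact_closed; [exact: cS|apply: compact_closed cS; exact: norm_hausdorff].
move=> _ [f /AL fL <-]; split=> [x|x y].
  by apply: le_trans (evB_le f x) _; rewrite ler_wpM2l.
by apply: le_trans (evB_lip f x y) _; rewrite ler_wpM2r.
Qed.
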